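(* There exist constants $\delta>0$ and $C>0$ such that the following holds for all sufficiently large $n$: for every positive integer $b\leq \frac{\delta n}{100\ln n}$, Maker can win the $(1:b)$ Perfect Matching game played on $E(K_n)$ within $\frac n2+Cb\ln b$ moves.
   Context: A $(1:b)$ Maker-Breaker game on the edge set $E(G)$ of a graph $G$: two players, Maker and Breaker, alternately claim previously unclaimed edges of $G$, with Breaker going first; in each move Breaker claims $b$ unclaimed edges and Maker claims one unclaimed edge. In the Perfect Matching game on $E(K_n)$, Maker wins if the graph of his claimed edges contains a perfect matching of $K_n$ (here $n$ is even); Breaker wins otherwise. ''Maker can win within $m$ moves'' means Maker has a strategy guaranteeing that his graph contains a winning set after at most $m$ of his own moves, whatever Breaker does. $\ln$ is the natural logarithm.
   Formalization: For b = 1 the stated bound n/2 + C b ln b equals n/2, which is impossible since Breaker can claim the last edge Maker needs; the formal theorem uses n/2 + C b ln(max(b,2)), so the bound is n/2 + C ln 2 when b = 1 and unchanged for b ≥ 2. *)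

(* Defs.v *)
From mathcomp Require Import all_boot.

Set Implicit Arguments.
Unset Strict Implicit.
Unset Printing Implicit Defensive.

Section MakerBreaker.

Variables (T : finType) (X : {set T}) (b : nat).

(* Maker answers the list of all moves made by Breaker so far, in the order in
   which they were played and including the one just made.  His own earlier
   moves are determined by that list. *)
Definition strategy := seq {set T} -> T.

Definition maker_claimed (s : strategy) (bs : seq {set T}) : {set T} :=
  [set s (take i.+1 bs) | i : 'I_(size bs)].

Definition breaker_claimed (bs : seq {set T}) : {set T} := \bigcup_(B <- bs) B.

Definition unclaimed (s : strategy) (bs : seq {set T}) : {set T} :=
  X :\: (maker_claimed s bs :|: breaker_claimed bs).

(* If fewer than b elements are unclaimed, Breaker takes all of them. *)
Definition breaker_legal (s : strategy) (bs : seq {set T}) : Prop :=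
  forall i, i < size bs ->
    nth set0 bs i \subset unclaimed s (take i bs) /\
    #|nth set0 bs i| = minn b #|unclaimed s (take i bs)|.

Definition maker_legal (s : strategy) (bs : seq {set T}) (i : nat) : Prop :=
  s (take i.+1 bs) \in unclaimed s (take i bs) :\: nth set0 bs i.

(* Maker must own a winning set after k <= m moves, all of them legal; what s
   prescribes after that point is irrelevant.  In particular, if the board is
   exhausted first then Maker has no further legal move and has not won. *)
Definition wins_within (F : {set {set T}}) (s : strategy) (m : nat) : Prop :=
  forall bs : seq {set T}, size bs = m -> breaker_legal s bs ->
    exists k, [/\ k <= m,
      forall i, i < k -> maker_legal s bs i &
      exists2 W, W \in F & W \subset maker_claimed s (take k bs)].

Definition maker_can_win_within (F : {set {set T}}) (m : nat) : Prop :=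
  exists s : strategy, wins_within F s m.

End MakerBreaker.

Definition Kn_edges (n : nat) : {set {set 'I_n}} := [set e : {set 'I_n} | #|e| == 2].

Definition perfect_matchings (n : nat) : {set {set {set 'I_n}}} :=
  [set M : {set {set 'I_n}} |
    (M \subset Kn_edges n) && partition M [set: 'I_n]].

(* Main.v *)
Require Import Defs.
From mathcomp Require Import all_boot all_order all_algebra.
From mathcomp Require Import reals sequences exp.
From mathcomp Require Import zify ring lra.

Set Implicit Arguments.
Unset Strict Implicit.
Unset Printing Implicit Defensive.

Import Order.TTheory GRing.Theory Num.Theory.

(* Let N be of order b ln b. While the set U of unmatched vertices has more than
   2N elements, Maker adds an edge vw inside U to his matching, controlling the
   potential sum_{x in U} (lam^d(x) - 1), where d(x) is Breaker's degree of x
   inside U and lam = 1 + 1/(64b). He takes for v a vertex of maximal degree,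
   which pays for Breaker's move, and for w a vertex whose removal lowers the
   potential by about twice its average or more: w contributes its own term and
   also lowers the degree of its neighbours. Together v and w remove almost three
   times the average, more than the two averages which the shrinking of U costs,
   so the average stays at most 1, whatever n is, and all degrees inside U are
   O(b ln |U|).

   When |U| = 2N, split U into halves A and B. Maker gives 16 edges to the other
   half to every vertex, always serving a vertex of maximal Breaker degree; by the
   same exponential potential at least 3N/4 choices remain available for it.
   Choosing the edges at random would leave, with positive probability, no set S
   with |S| <= N/2 in A or in B whose neighbourhood has size at most |S|; the
   method of conditional expectations makes the choices deterministic, and Hall's
   theorem completes the matching after O(N) moves. *)

(** * From winning positions to strategies *)

Section PositionalGame.

Variables (T : finType) (X : {set T}) (b : nat) (F : {set {set T}}).

Definition has_won (M : {set T}) : bool := [exists W in F, W \subset M].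

Definition free (M B : {set T}) : {set T} := X :\: (M :|: B).

(* Breaker, who is to move, may claim any number of elements up to b, which
   absorbs the rule for an almost exhausted board. *)
Fixpoint maker_wins (k : nat) (M B : {set T}) : bool :=
  has_won M ||
  if k is k'.+1 then
    [forall D : {set T}, (D \subset free M B) && (#|D| <= b) ==>
      [exists e in free M B :\: D, maker_wins k' (e |: M) (B :|: D)]]
  else false.

Lemma maker_wins_won k M B : has_won M -> maker_wins k M B.
Proof. by case: k => /= [|k] ->. Qed.

(** The half-round after Breaker's move: a win on the board is recognised before Maker moves, and
    otherwise [k] counts the moves left after the one he is about to make. *)
Definition maker_to_move_wins (k : nat) (M B : {set T}) : bool :=
  has_won M || [exists e in free M B, maker_wins k (e |: M) B].

Lemma maker_winsS k M B :
  (forall D : {set T}, D \subset free M B -> #|D| <= b ->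
     maker_to_move_wins k M (B :|: D)) ->
  maker_wins k.+1 M B.
Proof.
move=> H; have [/maker_wins_won->//|nw] := boolP (has_won M).
apply/orP; right; apply/forallP => D; apply/implyP => /andP[DX Db].
have := H D DX Db; rewrite /maker_to_move_wins (negPf nw) /=.
case/existsP=> e /andP[eX w]; apply/existsP; exists e; apply/andP; split=> //.
by move: eX; rewrite !inE !negb_or -!andbA => /and4P[-> -> -> ->].
Qed.

Lemma maker_wins_leq k k' M B : k <= k' -> maker_wins k M B -> maker_wins k' M B.
Proof.
elim: k k' M B => [|k IH] k' M B.
  by move=> _ /=; rewrite orbF => /maker_wins_won->.
case: k' => // k' le_kk' /= /orP[->//|/forallP H]; apply/orP; right.
apply/forallP => D; apply/implyP => DX; have /implyP/(_ DX)/existsP[e] := H D.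
by case/andP=> eX w; apply/existsP; exists e; rewrite eX (IH k').
Qed.

Lemma maker_to_move_wins_leq k k' M B :
  k <= k' -> maker_to_move_wins k M B -> maker_to_move_wins k' M B.
Proof.
move=> le_kk' /orP[w|/existsP[e /andP[eX w]]]; apply/orP; [by left | right].
by apply/existsP; exists e; rewrite eX (maker_wins_leq le_kk').
Qed.

Lemma maker_claimed_rcons (s : strategy T) bs D :
  maker_claimed s (rcons bs D) = s (rcons bs D) |: maker_claimed s bs.
Proof.
apply/setP=> e; rewrite in_setU1; apply/imsetP/orP.
- case=> -[i /= lti] _ ->; move: (lti); rewrite size_rcons ltnS leq_eqVlt.
  case/orP=> [/eqP ->|lt_is].
    by left; rewrite -(size_rcons bs D) take_size.
  right; apply/imsetP; exists (Ordinal lt_is) => //=.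
  by rewrite -cats1 takel_cat.
- case=> [/eqP->|/imsetP[i _ ->]].
    have lt_b : size bs < size (rcons bs D) by rewrite size_rcons.
    by exists (Ordinal lt_b) => //=; rewrite -(size_rcons bs D) take_size.
  have lt_b : i < size (rcons bs D) by rewrite size_rcons ltnS ltnW.
  by exists (Ordinal lt_b) => //=; rewrite -cats1 takel_cat.
Qed.

Lemma breaker_claimed_rcons bs (D : {set T}) :
  breaker_claimed (rcons bs D) = breaker_claimed bs :|: D.
Proof. by rewrite /breaker_claimed -cats1 big_cat big_seq1. Qed.

Section WinningStrategy.

Variables (x0 : T) (m : nat).

(** The state holds the moves left, both players' sets and Maker's last answer; [x0] is answered
    only when no winning reply exists. *)
Definition round (p : nat * {set T} * {set T} * T) (D : {set T}) :=
  let: (k, M, B, _) := p in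
  let e := odflt x0 [pick e in free M B :\: D |
                       maker_wins k.-1 (e |: M) (B :|: D)] in
  (k.-1, e |: M, B :|: D, e).

Definition winning_strategy : strategy T :=
  fun bs => (foldl round (m, set0, set0, x0) bs).2.

Lemma winning_strategyE bs :
  (foldl round (m, set0, set0, x0) bs).1 =
  (m - size bs, maker_claimed winning_strategy bs, breaker_claimed bs).
Proof.
elim/last_ind: bs => [|bs D IH].
  rewrite /= subn0 /breaker_claimed big_nil; congr (_, _, _).
  by apply/esym/setP=> e; rewrite inE; apply/imsetP=> -[[]].
rewrite maker_claimed_rcons breaker_claimed_rcons {1}/winning_strategy foldl_rcons.
case: foldl IH => [[[k M] B] e] /= [-> -> ->].
by rewrite size_rcons subnS.
Qed.

Lemma maker_can_win_of_wins : maker_wins m set0 set0 -> maker_can_win_within X b F m.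
Proof.
move=> w0; exists winning_strategy => bs size_bs legal.
(* Either Maker has already won by legal moves, or his first [i] answers were legal and the position
   still wins with [m - i] moves. *)
suff H i : i <= m ->
    (exists k, [/\ k <= m, forall j, j < k -> maker_legal X winning_strategy bs j &
       exists2 W, W \in F & W \subset maker_claimed winning_strategy (take k bs)]) \/
    (forall j, j < i -> maker_legal X winning_strategy bs j) /\
    maker_wins (m - i) (maker_claimed winning_strategy (take i bs))
                       (breaker_claimed (take i bs)).
  case: (H m (leqnn m)) => // -[lg]; rewrite subnn /= orbF.
  by case/existsP=> W /andP[WF WM]; exists m; split=> //; exists W.
elim: i => [_|i IH lt_im].
  right; split=> //; rewrite take0 subn0 /breaker_claimed big_nil.
  suff -> : maker_claimed winning_strategy [::] = set0 by [].
  by apply/setP=> e; rewrite inE; apply/imsetP=> -[[]].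
have [|[lg]] := IH (ltnW lt_im); first by left.
have lt_ib : i < size bs by rewrite size_bs.
have size_take_i : size (take i bs) = i by rewrite size_take lt_ib.
rewrite -[m - i]prednK ?subn_gt0 // -subnS /= => /orP[|/forallP H].
  case/existsP=> W /andP[WF WM]; left; exists i; split=> //; first exact: ltnW.
  by exists W.
set D := nth set0 bs i; have [DX Dc] := legal i lt_ib.
have {H} /implyP := H D; rewrite -/(unclaimed X winning_strategy (take i bs)) in DX Dc *.
rewrite /free -/(unclaimed X winning_strategy (take i bs)) DX Dc geq_minl => /(_ isT) H.
have E : take i.+1 bs = rcons (take i bs) D by rewrite (take_nth set0).
have := winning_strategyE (take i bs).
have := maker_claimed_rcons winning_strategy (take i bs) D.
have := breaker_claimed_rcons (take i bs) D.
rewrite -E => EB EM run.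
have [sX sw] : winning_strategy (take i.+1 bs) \in unclaimed X winning_strategy (take i bs) :\: D /\
   maker_wins (m - i.+1) (winning_strategy (take i.+1 bs) |: maker_claimed winning_strategy (take i bs))
     (breaker_claimed (take i bs) :|: D).
  rewrite {1 3}/winning_strategy E foldl_rcons.
  case: foldl run => [[[k M] B] e] [-> -> ->]; rewrite /= size_take_i -subnS.
  case: pickP => [e' /andP[]//|no]; case/existsP: H => e' /andP[e'X we'].
  by have := no e'; rewrite we' andbT /free -/(unclaimed X winning_strategy (take i bs)) e'X.
right; split; last by rewrite EM EB.
by move=> j; rewrite ltnS leq_eqVlt => /orP[/eqP->|/lg].
Qed.

End WinningStrategy.

End PositionalGame.

(** * Hall's marriage theorem *)

Section Hall.

Variable V : finType.
Implicit Types (r : rel V) (A S : {set V}).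

Definition nbhd r S : {set V} := [set y | [exists x in S, r x y]].

Lemma nbhdP r S y : reflect (exists2 x, x \in S & r x y) (y \in nbhd r S).
Proof. by rewrite inE; apply: exists_inP. Qed.

Lemma nbhdU r S1 S2 : nbhd r (S1 :|: S2) = nbhd r S1 :|: nbhd r S2.
Proof.
apply/setP=> y; rewrite in_setU; apply/nbhdP/orP.
  by case=> x /setUP[xS|xS] rxy; [left | right]; apply/nbhdP; exists x.
by case=> /nbhdP[x xS rxy]; exists x; rewrite // inE xS ?orbT.
Qed.

Lemma nbhdD r S (Z : {set V}) :
  nbhd (fun x y => r x y && (y \notin Z)) S = nbhd r S :\: Z.
Proof.
apply/setP=> y; rewrite in_setD; apply/nbhdP/andP.
  by case=> x xS /andP[rxy yZ]; split=> //; apply/nbhdP; exists x.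
by case=> yZ /nbhdP[x xS rxy]; exists x; rewrite ?rxy.
Qed.

(** Induction on the size of [A], for all relations at once because both cases restrict [r]. *)
Theorem hall_marriage r A :
  (forall S, S \subset A -> #|S| <= #|nbhd r S|) ->
  exists f : V -> V, {in A &, injective f} /\ {in A, forall x, r x (f x)}.
Proof.
elim: {A}_.+1 {-2}A (ltnSn #|A|) r => // k IH A; rewrite ltnS => le_Ak r hall.
have [->|/set0Pn[a aA]] := eqVneq A set0.
  by exists id; split=> [x y|x]; rewrite inE.
(* A tight proper subset [S] is matched into its neighbourhood. The rest avoids that neighbourhood:
   Hall's condition for [T] follows from the one for [S :|: T]. *)
have [/existsP[S /and4P[SA S0 Sn tight]]|/existsPn noS] := boolP
    [exists S : {set V}, [&& S \subset A, S != set0, S != A & #|nbhd r S| <= #|S|]].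
  have lt_S : #|S| < #|A| by apply: proper_card; rewrite properEneq Sn.
  have [|S' S'S|f1 [inj1 r1]] := IH S _ r; first exact: leq_trans lt_S le_Ak.
    exact: hall (subset_trans S'S SA).
  have [|T TA|f2 [inj2 r2]] :=
    IH (A :\: S) _ (fun x y => r x y && (y \notin nbhd r S)).
  - rewrite cardsD (setIidPr SA); apply: leq_trans le_Ak.
    by rewrite ltn_subrL !card_gt0 S0; apply/set0Pn; exists a.
  - have {TA} [TA dTS] : T \subset A /\ S :&: T = set0.
      split; first exact: subset_trans TA (subsetDl _ _).
      apply/setP=> x; rewrite !inE; apply/andP=> -[xS xT].
      by have := subsetP TA _ xT; rewrite !inE xS.
    rewrite nbhdD; have := hall (S :|: T); rewrite subUset SA TA => /(_ isT).
    rewrite nbhdU cardsU dTS cards0 subn0.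
    have -> : nbhd r S :|: nbhd r T = nbhd r S :|: (nbhd r T :\: nbhd r S).
      by apply/setP=> y; rewrite !in_setU in_setD; case: (y \in nbhd r S).
    rewrite cardsU [X in _ - X](_ : _ = 0) ?subn0; last first.
      apply/eqP; rewrite cards_eq0; apply/eqP/setP=> y.
      by rewrite in_setI in_setD in_set0; case: (y \in nbhd r S).
    move=> h.
    by rewrite -(leq_add2l #|S|); apply: leq_trans h _; rewrite leq_add2r.
  exists (fun x => if x \in S then f1 x else f2 x); split; last first.
    move=> x xA; case: ifP => xS; first exact: r1.
    by have /andP[] := r2 x ltac:(by rewrite inE xS).
  have sep x y : x \in S -> y \in A -> y \notin S -> f1 x <> f2 y.
    move=> xS yA yS e; have /andP[_] := r2 y ltac:(by rewrite inE yS).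
    rewrite -e => /negP[]; apply/nbhdP; exists x => //; exact: r1.
  move=> x y xA yA; case: ifPn => xS; case: ifPn => yS.
  - exact: inj1.
  - by move/sep=> [].
  - by move/esym/sep=> [].
  - by apply: inj2; rewrite inE ?xS ?yS.
(* Without tight subsets every nonempty proper subset has a spare neighbour, so any edge at [a] may
   be fixed and its end [y] deleted. *)
have [y rya] : exists y, r a y.
  have := hall [set a]; rewrite sub1set cards1 aA => /(_ isT).
  by rewrite card_gt0 => /set0Pn[y /nbhdP[x /set1P->]]; exists y.
have [|S SA|f [injf rf]] := IH (A :\ a) _ (fun x z => r x z && (z \notin [set y])).
- by move: le_Ak; rewrite (cardsD1 a) aA.
- rewrite nbhdD; have [->|S0] := eqVneq S set0; first by rewrite cards0.
  have := noS S; rewrite (subset_trans SA (subsetDl _ _)) S0 /=.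
  have -> /= : S != A by apply: contraTneq SA => ->; apply/subsetPn; exists a; rewrite ?inE ?eqxx.
  by rewrite -ltnNge (cardsD1 y (nbhd r S)); case: (y \in _); [|move/ltnW].
exists (fun x => if x == a then y else f x); split; last first.
  move=> x xA; case: eqP => [->//|/eqP xa].
  by have /andP[] := rf x ltac:(by rewrite !inE xa).
have sep x : x \in A -> x != a -> f x != y.
  move=> xA xa; have /andP[_] := rf x ltac:(by rewrite !inE xa).
  by rewrite inE.
move=> x z xA zA; case: eqP => [->|/eqP xa]; case: eqP => [->//|/eqP za].
- by move=> e; have := sep z zA za; rewrite e eqxx.
- by move=> e; have := sep x xA xa; rewrite e eqxx.
by apply: injf; rewrite !inE ?xa ?za.
Qed.

End Hall.

(** * Matchings and expansion *)

Lemma subset_of_card (T : finType) (A : {set T}) k :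
  k <= #|A| -> exists2 B : {set T}, B \subset A & #|B| = k.
Proof.
rewrite -bin_gt0 -cards_draws card_gt0 => /set0Pn[B].
by rewrite inE => /andP[BA /eqP]; exists B.
Qed.

Lemma extend_to_card (T : finType) (N A : {set T}) k :
  N \subset A -> #|N| <= k <= #|A| ->
  exists B : {set T}, [/\ N \subset B, B \subset A & #|B| = k].
Proof.
move=> NA /andP[Nk kA]; have [|B BA cB] := @subset_of_card _ (A :\: N) (k - #|N|).
  by rewrite cardsD (setIidPr NA) leq_sub2r.
exists (N :|: B); split; first exact: subsetUl.
  by rewrite subUset NA (subset_trans BA (subsetDl _ _)).
rewrite cardsU (_ : N :&: B = set0) ?cards0 ?subn0 ?cB ?subnKC //.
apply/setP=> x; rewrite !inE; apply/andP=> -[xN xB].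
by have := subsetP BA _ xB; rewrite !inE xN.
Qed.

Section Matchings.

Variable n : nat.
Implicit Types (M : {set {set 'I_n}}) (U S A B : {set 'I_n}).

Definition matched M U : bool :=
  [exists W : {set {set 'I_n}},
     [&& W \subset M, W \subset Kn_edges n & partition W U]].

Lemma matched0 M : matched M set0.
Proof. by apply/existsP; exists set0; rewrite !sub0set partition_set0 eqxx. Qed.

Lemma matchedS M M' U : M \subset M' -> matched M U -> matched M' U.
Proof.
move=> MM' /existsP[W /and3P[WM WE pW]]; apply/existsP; exists W.
by rewrite (subset_trans WM MM') WE.
Qed.

Lemma matchedU2 M U v w : matched M U -> v \notin U -> w \notin U -> v != w ->
  [set v; w] \in M -> matched M ([set v; w] :|: U).
Proof.
move=> /existsP[W /and3P[WM WE pW]] vU wU vw eM.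
apply/existsP; exists ([set v; w] |: W); rewrite !subUset !sub1set eM WM WE.
rewrite inE cards2 vw /= partitionU1 //.
  by apply/set0Pn; exists v; rewrite !inE eqxx.
by rewrite disjoints_subset; apply/subsetP=> x; rewrite !inE => /orP[]/eqP->.
Qed.

Lemma has_won_matched M : matched M [set: 'I_n] -> has_won (perfect_matchings n) M.
Proof.
case/existsP=> W /and3P[WM WE pW]; apply/exists_inP; exists W => //.
by rewrite inE WE.
Qed.

(** * Expansion on both sides yields a perfect matching *)

Section Bipartite.

Variables (A B : {set 'I_n}) (h : nat).

Definition other_side v := if v \in A then B else A.

(* A pair (S, T) that is confined for Maker's graph witnesses #|N(S)| <= #|S|
   for a set S contained in one of the two sides. *)
Definition critical_pairs : {set {set 'I_n} * {set 'I_n}} :=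
  [set P : {set 'I_n} * {set 'I_n} |
    [&& (P.1 \subset A) && (P.2 \subset B) || (P.1 \subset B) && (P.2 \subset A),
        #|P.1| == #|P.2|, 0 < #|P.1| & #|P.1| <= h]].

Definition confined M (P : {set 'I_n} * {set 'I_n}) : bool :=
  [forall v in P.1, forall y in other_side v, ([set v; y] \in M) ==> (y \in P.2)].

Hypotheses (disjAB : [disjoint A & B]) (cardA : #|A| = h.*2) (cardB : #|B| = h.*2).

Lemma other_sideA v : v \in A -> other_side v = B.
Proof. by rewrite /other_side => ->. Qed.

Lemma other_sideB v : v \in B -> other_side v = A.
Proof. by rewrite /other_side; case: ifP => // /(disjointFr disjAB)->. Qed.

Section Expansion.

Variable M : {set {set 'I_n}}.
Hypothesis not_confined : forall P, P \in critical_pairs -> ~~ confined M P.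

Let adj v y := (y \in other_side v) && ([set v; y] \in M).

(** Otherwise the neighbourhood of [S] could be enlarged within the other side to a set of exactly
    #|S| vertices, giving a confined critical pair. *)
Lemma small_sets_expand S : (S \subset A) || (S \subset B) -> 0 < #|S| <= h ->
  #|S| < #|nbhd adj S|.
Proof.
move=> SAB /andP[S0 Sh]; rewrite ltnNge; apply/negP=> NS.
pose Z := if S \subset A then B else A.
have cardZ : #|Z| = h.*2 by rewrite /Z; case: ifP.
have SZ v : v \in S -> other_side v = Z.
  rewrite /Z; case: ifP SAB => /= [SA _|_ SB] vS.
    by rewrite other_sideA ?(subsetP SA).
  by rewrite other_sideB ?(subsetP SB).
have NZ : nbhd adj S \subset Z.
  by apply/subsetP=> y /nbhdP[v vS /andP[]]; rewrite SZ.
have [|T [NT TZ cT]] := extend_to_card NZ (k := #|S|).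
  by rewrite NS cardZ; lia.
have /not_confined/negP[] : (S, T) \in critical_pairs.
  rewrite inE /= cT eqxx S0 Sh !andbT; move: TZ; rewrite /Z.
  by case: ifP SAB => /= [_ _ ->|_ -> ->].
apply/forall_inP=> v vS; apply/forall_inP=> y yv; apply/implyP=> e.
by apply: (subsetP NT); apply/nbhdP; exists v; rewrite // /adj yv.
Qed.

(** If a set [S] with more than [h] vertices failed, B minus its neighbourhood would contain a set
    [S'] of 2h - #|S| + 1 <= h vertices. All neighbours of [S'] lie in A minus [S], which has only
    2h - #|S| vertices, so [S'] does not expand. This is why critical pairs run over both sides. *)
Lemma hall_condition S : S \subset A -> #|S| <= #|nbhd adj S|.
Proof.
move=> SA; have [->|S0] := eqVneq S set0; first by rewrite cards0.
have [Sh|hS] := leqP #|S| h.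
  by apply/ltnW/small_sets_expand; rewrite ?SA // card_gt0 S0.
rewrite leqNgt; apply/negP=> NS.
have NB : nbhd adj S \subset B.
  apply/subsetP=> y /nbhdP[v vS /andP[]].
  by rewrite other_sideA ?(subsetP SA).
have SAh : #|S| <= h.*2 by rewrite -cardA subset_leq_card.
have [|S' S'B cS'] := @subset_of_card _ (B :\: nbhd adj S) (h.*2 - #|S|).+1.
  by rewrite cardsD (setIidPr NB) cardB; lia.
have S'sB : S' \subset B by exact: subset_trans S'B (subsetDl _ _).
have := @small_sets_expand S'; rewrite S'sB orbT cS' => /(_ isT).
suff : #|nbhd adj S'| <= #|A :\: S|.
  by rewrite cardsD (setIidPr SA) cardA; lia.
apply/subset_leq_card/subsetP=> y /nbhdP[v vS' /andP[]].
have vB := subsetP S'sB _ vS'; rewrite other_sideB // => yA e.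
rewrite inE yA andbT; apply/negP=> yS.
have := subsetP S'B _ vS'; rewrite in_setD => /andP[/negP[]].
by apply/nbhdP; exists y => //; rewrite /adj other_sideA // vB setUC.
Qed.

(** The edges from Hall's theorem are added one at a time to the matching outside A and B;
    injectivity and equal sizes make them cover both sides. *)
Lemma not_confined_matched : matched M (~: (A :|: B)) -> matched M [set: 'I_n].
Proof.
move=> m0; have [f [injf adjf]] := hall_marriage hall_condition.
have fB v : v \in A -> f v \in B.
  by move=> vA; have /andP[] := adjf v vA; rewrite other_sideA.
have imf : f @: A = B.
  apply/eqP; rewrite eqEcard card_in_imset // cardA cardB leqnn andbT.
  by apply/subsetP=> y /imsetP[v vA ->]; exact: fB.
suff H k (A' : {set 'I_n}) : #|A'| = k -> A' \subset A ->
    matched M ((A' :|: f @: A') :|: ~: (A :|: B)).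
  by have := H _ A erefl (subxx _); rewrite imf setUCr.
elim: k A' => [|k IH] A'.
  by move/eqP; rewrite cards_eq0 => /eqP-> _; rewrite imset0 !set0U.
move=> cA' A'A; have /set0Pn[v vA'] : A' != set0 by rewrite -card_gt0 cA'.
have vA := subsetP A'A _ vA'.
have /IH : #|A' :\ v| = k by move: cA'; rewrite (cardsD1 v) vA' => -[].
have A'vA := subset_trans (subsetDl A' [set v]) A'A.
move=> /(_ A'vA) /(@matchedU2 _ _ v (f v)); rewrite !in_setU !in_setC !in_setU.
have vnB : v \notin B by rewrite (disjointFr disjAB).
have fvnA : f v \notin A by rewrite (disjointFl disjAB) ?fB.
have vnf : v \in f @: (A' :\ v) = false.
  apply/negbTE/imsetP=> -[x /(subsetP A'vA) /fB xB e].
  by move: vnB; rewrite e xB.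
have fvn : f v \in f @: (A' :\ v) = false.
  apply/negbTE/imsetP=> -[x xA' /injf e].
  by move: (xA'); rewrite -e ?(subsetP A'vA x xA') // !inE eqxx.
have fvA' : f v \in A' :\ v = false.
  by apply: contraNF fvnA => /(subsetP A'vA).
rewrite vA fB // vnf fvn fvA' !inE eqxx /= orbT => /(_ isT isT).
have -> : v != f v by apply: contraNneq vnB => ->; exact: fB.
have /andP[_ ->] := adjf v vA; move=> /(_ isT isT).
have imA' : f @: A' = f v |: f @: (A' :\ v) by rewrite -imsetU1 setD1K.
suff <- : [set v; f v] :|: (A' :\ v :|: f @: (A' :\ v)) = A' :|: f @: A'.
  by rewrite -(setUA [set v; f v]).
by rewrite imA' -[X in _ = X :|: _](setD1K vA') -!setUA (setUCA (A' :\ v)).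
Qed.

End Expansion.

End Bipartite.

End Matchings.

Local Open Scope ring_scope.

(** * Numerical estimates *)

Section RealEstimates.

Variable R : realType.

Lemma bernoulli (x : R) d : 0 <= x -> 1 + d%:R * x <= (1 + x) ^+ d.
Proof.
move=> x0; elim: d => [|d IH]; first by rewrite mul0r addr0 expr0.
rewrite exprS; apply: le_trans (ler_wpM2l _ IH); last by rewrite addr_ge0.
have : 0 <= d%:R * x * x by rewrite !mulr_ge0.
rewrite -natr1; nra.
Qed.

(** x^d - 1 is the sum of the d terms (x - 1) x^i with i < d, each at most (x - 1) x^(d-1) = (1 -
    1/x) x^d. *)
Lemma expr_sub1_le (x : R) d : 1 <= x -> x ^+ d - 1 <= d%:R * (1 - x^-1) * x ^+ d.
Proof.
move=> x1; have x0 : 0 < x by exact: lt_le_trans x1.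
elim: d => [|d IH]; first by rewrite expr0 subrr !mul0r.
have xd1 : 1 <= x ^+ d by rewrite exprn_ege1.
have E : (1 - x^-1) * x ^+ d.+1 = (x - 1) * x ^+ d.
  by rewrite exprS mulrA mulrBl mul1r mulVf ?gt_eqF.
have E' : (1 - x^-1) * x ^+ d <= (1 - x^-1) * x ^+ d.+1.
  rewrite ler_wpM2l // ?subr_ge0 ?invf_le1 // exprS ler_peMl //.
  by rewrite (le_trans _ xd1).
rewrite -mulrA -natr1 mulrDl mul1r.
apply: le_trans (_ : d%:R * ((1 - x^-1) * x ^+ d) + (x - 1) * x ^+ d <= _).
  by move: IH; rewrite exprS -mulrA; nra.
by rewrite E lerD2r -E ler_wpM2l.
Qed.

(* With 64 here, a move of Breaker raises the sum of the weights
   growth_rate b ^+ deg x by at most 1/16 of the largest weight. *)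
Definition growth_rate (b : nat) : R := 1 + (64 * b%:R)^-1.

Section GrowthRate.

Variables (b : nat).
Hypothesis b0 : (0 < b)%N.
Let lam := growth_rate b.

Let b0R : 0 < b%:R :> R. Proof. by rewrite ltr0n. Qed.

Lemma growth_rate_ge1 : 1 <= lam.
Proof. by rewrite lerDl invr_ge0 mulr_ge0 // ltW. Qed.

Lemma growth_rate_gt0 : 0 < lam.
Proof. exact: lt_le_trans growth_rate_ge1. Qed.

(** The power is at most exp(1/64), and exp(-1/64) >= 1/2. Hence one move of Breaker at most doubles
    a weight. *)
Lemma growth_rate_pow_b : lam ^+ b <= 2.
Proof.
have : lam ^+ b <= expR (64^-1).
  have -> : 64^-1 = b%:R * (64 * b%:R)^-1 :> R.
    by field; rewrite gt_eqF.
  rewrite expRM_natl lerXn2r ?nnegrE ?expR_ge0 ?(ltW growth_rate_gt0) //.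
  exact: expR_ge1Dx.
move/le_trans; apply.
have := expR_ge1Dx (- 64^-1 : R); rewrite expRN => h.
have e0 := expR_gt0 (64^-1 : R).
have : expR (64^-1) * (expR (64^-1))^-1 = 1 :> R by rewrite divff ?gt_eqF.
have : (1 / 2 : R) <= (expR 64^-1)^-1 by apply: le_trans h; lra.
nra.
Qed.

Lemma growth_rate_pow_doubling : 2 <= lam ^+ (64 * b).
Proof.
have := @bernoulli (64 * b%:R)^-1 (64 * b) _.
rewrite -/lam natrM divff ?gt_eqF ?mulr_gt0 //; apply.
by rewrite invr_ge0 mulr_ge0 // ltW.
Qed.

Lemma growth_rate_inv : 1 - lam^-1 <= (64 * b%:R)^-1.
Proof.
have -> : (64 * b%:R)^-1 = lam - 1 :> R by rewrite /lam /growth_rate addrC addKr.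
have l1 := growth_rate_ge1; have l0 := growth_rate_gt0.
have : lam * lam^-1 = 1 by rewrite divff ?gt_eqF.
have : 0 < lam^-1 by rewrite invr_gt0.
by nra.
Qed.

(** Linearises the growth of a weight within one move, so that the increases can be summed over
    Breaker's new edges. *)
Lemma growth_rate_sub1 e : (e <= b)%N -> lam ^+ e - 1 <= e%:R / (32 * b%:R).
Proof.
move=> eb; apply: le_trans (expr_sub1_le _ growth_rate_ge1) _.
have l1 := growth_rate_ge1; have l0 := growth_rate_gt0.
have le2 : lam ^+ e <= 2.
  by apply: le_trans growth_rate_pow_b; rewrite ler_weXn2l.
have -> : e%:R / (32 * b%:R) = e%:R * (64 * b%:R)^-1 * 2 :> R.
  by field; rewrite gt_eqF.
have h0 : 0 <= 1 - lam^-1 by rewrite subr_ge0 invf_le1.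
apply: ler_pM => //; first by rewrite mulr_ge0.
  by rewrite exprn_ge0 // ltW.
by rewrite ler_wpM2l // growth_rate_inv.
Qed.

Lemma leq_exp2_half q : (6 <= q)%N -> (q.+1 <= 2 ^ q./2)%N.
Proof.
move=> q6; rewrite -(subnKC q6); move: (q - 6)%N => k {q6 q}.
suff H j : (j.*2 + 8 <= 2 ^ (3 + j))%N.
  rewrite halfD /= (_ : 3 = 6./2)%N //; apply: leq_trans (H k./2).
  by have := odd_double_half k; case: odd => /=; lia.
by elim: j => // j IH; rewrite (addnS 3) expnS; lia.
Qed.

(** The weight doubles every 64b degrees. A degree above N/4 means q >= 99L doublings, while 128N is
    below 128 * 256 * b * (q + 1), hence below 2^(15+L) * 2^(q/2), which 2^q exceeds. *)
Lemma growth_rate_degree L N d :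
  (b < 2 ^ L)%N -> (0 < L)%N -> (100 * 256 * b * L <= N)%N ->
  lam ^+ d <= 128 * N%:R -> (4 * d <= N)%N.
Proof.
move=> bL L0 NL ld; rewrite leqNgt; apply/negP=> Nd.
pose q := (d %/ (64 * b))%N.
have b64 : (0 < 64 * b)%N by rewrite muln_gt0.
have dq : (d < (q.+1) * (64 * b))%N by exact: ltn_ceil.
have qd : (64 * b * q <= d)%N by rewrite mulnC; exact: leq_divM.
have Lq : (99 * L <= q)%N.
  rewrite -ltnS -(ltn_pmul2r b64); apply: leq_ltn_trans dq; nia.
have : (2 ^ q)%:R <= 128 * N%:R :> R.
  apply: le_trans ld; rewrite natrX.
  apply: le_trans (ler_weXn2l growth_rate_ge1 qd).
  by rewrite exprM lerXn2r ?nnegrE ?exprn_ge0 ?(ltW growth_rate_gt0) // growth_rate_pow_doubling.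
rewrite -natrM ler_nat leqNgt => /negP[].
have h1 : (q.+1 <= 2 ^ q./2)%N by apply: leq_exp2_half; lia.
have h2 : (2 ^ (15 + L) <= 2 ^ (q - q./2))%N by rewrite leq_exp2l //; lia.
have -> : (2 ^ q = 2 ^ q./2 * 2 ^ (q - q./2))%N by rewrite -expnD; congr (_ ^ _)%N; lia.
apply: leq_trans (leq_mul h1 h2); rewrite expnD.
rewrite (_ : 2 ^ 15 = 128 * 256)%N; last by rewrite -[15%N]/(7 + 8)%N expnD.
nia.
Qed.

End GrowthRate.

(** The left side is one term of the binomial expansion of (1 + s/N)^N, which is at most e^s; e <= 4
    because exp(-1/2) >= 1/2. *)
Lemma bin_ratio_le N s : (0 < N)%N -> 'C(N, s)%:R * (s%:R / N%:R) ^+ s <= 4 ^+ s :> R.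
Proof.
move=> N0; have N0R : 0 < N%:R :> R by rewrite ltr0n.
have [sN|Ns] := leqP s N; last by rewrite bin_small // mul0r exprn_ge0.
set x : R := s%:R / N%:R; have x0 : 0 <= x by rewrite divr_ge0.
apply: le_trans (_ : (1 + x) ^+ N <= _).
  rewrite exprDn (bigD1 (Ordinal (sN : (s < N.+1)%N))) //= expr1n mul1r.
  rewrite -[X in _ <= X + _]mulr_natl.
  rewrite lerDl sumr_ge0 // => i _.
  by rewrite mulrn_wge0 // mulr_ge0 ?exprn_ge0.
apply: le_trans (_ : expR x ^+ N <= _).
  by rewrite lerXn2r ?nnegrE ?expR_ge0 ?addr_ge0 // expR_ge1Dx.
rewrite -expRM_natl (_ : N%:R * x = (2 * s)%:R * 2^-1); last first.
  by rewrite natrM /x; field; rewrite gt_eqF.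
rewrite expRM_natl exprM lerXn2r ?nnegrE ?exprn_ge0 ?expR_ge0 //.
have := expR_ge1Dx (- 2^-1 : R); rewrite expRN => h.
have e0 := expR_gt0 (2^-1 : R).
have : expR (2^-1) * (expR (2^-1))^-1 = 1 :> R by rewrite divff ?gt_eqF.
nra.
Qed.

(** For i = 2 and j = 14: of the sixteen factors x^s two absorb the binomial coefficients, and the
    other fourteen make the term small. *)
Lemma regroup_powers (c q x : R) (i j s : nat) :
  c ^+ i * (q * x) ^+ ((i + j) * s) = (c * x ^+ s) ^+ i * (q ^+ (i + j) * x ^+ j) ^+ s.
Proof.
rewrite !exprMn -!exprM mulnDl !exprD (mulnC s); ring.
Qed.

(* Bounds the probability that a random element of a set of at least 3N/4
   vertices falls into a given set of s vertices. *)
Definition confinement_rate (N s : nat) : R := 4 * s%:R / (3 * N%:R).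

(** Since s/N <= 1/2, the term for s is at most (16 * (4/3)^16 / 2^14)^s <= 4^(-s), and these add up
    to less than 1/3. *)
Lemma sum_confinement_lt (h : nat) : (0 < h)%N ->
  \sum_(1 <= s < h.+1) 'C(h.*2, s)%:R ^+ 2 * confinement_rate h.*2 s ^+ (16 * s) < 2^-1 :> R.
Proof.
move=> h0; have h0R : 0 < h%:R :> R by rewrite ltr0n.
have N0R : 0 < h.*2%:R :> R by rewrite ltr0n double_gt0.
apply: le_lt_trans (_ : \sum_(1 <= s < h.+1) 4^-1 ^+ s < _).
  apply: ler_sum_nat => s /andP[s1 sh].
  set x : R := s%:R / h.*2%:R.
  have x0 : 0 <= x by rewrite divr_ge0.
  have x1 : x <= 2^-1.
    rewrite ler_pdivrMr // -muln2 natrM.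
    have : s%:R <= h%:R :> R by rewrite ler_nat.
    lra.
  have -> : confinement_rate h.*2 s = (4 / 3) * x.
    by rewrite /confinement_rate /x; field; rewrite gt_eqF.
  have -> : 'C(h.*2, s)%:R ^+ 2 * (4 / 3 * x) ^+ (16 * s) =
     ('C(h.*2, s)%:R * x ^+ s) ^+ 2 * ((4 / 3) ^+ 16 * x ^+ 14) ^+ s :> R.
    exact: (regroup_powers _ _ _ 2 14).
  have [q qE] : exists q : R, q = 4 / 3 by exists (4 / 3).
  rewrite -qE; have q0 : 0 <= q by rewrite qE; lra.
  have h1 : ('C(h.*2, s)%:R * x ^+ s) ^+ 2 <= (4 ^+ s) ^+ 2 :> R.
    by rewrite lerXn2r ?nnegrE ?mulr_ge0 ?exprn_ge0 // bin_ratio_le // double_gt0.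
  have h2 : (q ^+ 16 * x ^+ 14) ^+ s <= (q ^+ 16 * 2^-1 ^+ 14) ^+ s.
    apply: lerXn2r; rewrite ?nnegrE; do ?by rewrite mulr_ge0 ?exprn_ge0 ?invr_ge0.
    by rewrite ler_wpM2l ?exprn_ge0 // lerXn2r ?nnegrE ?invr_ge0.
  apply: le_trans (ler_pM _ _ h1 h2) _; do ?by rewrite exprn_ge0 // mulr_ge0 ?exprn_ge0.
  rewrite exprAC -exprMn; apply: lerXn2r; rewrite ?nnegrE.
  - by rewrite !mulr_ge0 ?exprn_ge0 ?invr_ge0.
  - by rewrite invr_ge0.
  - rewrite qE; lra.
have := subrX1 (4^-1 : R) h.+1.
rewrite -(big_mkord xpredT (fun i => 4^-1 ^+ i)) big_ltn //.
have : 0 < (4^-1 : R) ^+ h.+1 by rewrite exprn_gt0 // invr_gt0.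
rewrite expr0; lra.
Qed.

End RealEstimates.

(** * Breaker's degrees *)

Lemma exists_max_in (T : finType) (A : {set T}) (f : T -> nat) v0 : v0 \in A ->
  exists2 v, v \in A & forall x, x \in A -> (f x <= f v)%N.
Proof.
by move=> v0A; case: (@arg_maxnP _ v0 (mem A) f v0A) => v vA vmax; exists v.
Qed.

Section Degrees.

Variable n : nat.
Implicit Types (B D : {set {set 'I_n}}) (U : {set 'I_n}).

Definition nbrs U B (x : 'I_n) : {set 'I_n} := [set y in U | [set x; y] \in B].

Definition deg U B x : nat := #|nbrs U B x|.

Lemma in_Kn (x y : 'I_n) : ([set x; y] \in Kn_edges n) = (x != y).
Proof. by rewrite inE cards2; case: (x == y). Qed.

Lemma nbrs_irr U B x : B \subset Kn_edges n -> x \notin nbrs U B x.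
Proof.
move=> BK; rewrite inE negb_and; apply/orP; right; apply/negP=> /(subsetP BK).
by rewrite in_Kn eqxx.
Qed.

Lemma nbrs_sym U B x y : x \in U -> y \in U -> (y \in nbrs U B x) = (x \in nbrs U B y).
Proof. by move=> xU yU; rewrite !inE xU yU setUC. Qed.

Lemma deg_le_incident U D x : D \subset Kn_edges n ->
  (deg U D x <= #|[set f in D | x \in f]|)%N.
Proof.
move=> DK; rewrite /deg -(@card_in_imset _ _ (fun y => [set x; y])).
  apply/subset_leq_card/subsetP=> f /imsetP[y]; rewrite !inE => /andP[_ fD] ->.
  by rewrite fD !inE eqxx.
move=> y z /[!inE] /andP[_ /(subsetP DK)] + /andP[_ /(subsetP DK)].
rewrite !in_Kn => xy xz /setP/(_ y).
by rewrite !inE eqxx orbT eq_sym (negPf xy) /= => /esym/eqP.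
Qed.

Lemma deg_le_card U D x : D \subset Kn_edges n -> (deg U D x <= #|D|)%N.
Proof.
move=> DK; apply: leq_trans (deg_le_incident U x DK) (subset_leq_card _).
by apply/subsetP=> f; rewrite inE => /andP[].
Qed.

Lemma sum_deg_le U D : D \subset Kn_edges n ->
  (\sum_(x in U) deg U D x <= 2 * #|D|)%N.
Proof.
move=> DK; apply: leq_trans (_ : \sum_(x : 'I_n) #|[set f in D | x \in f]| <= _)%N.
  rewrite big_mkcond /=; apply: leq_sum => x _.
  by case: ifP => // _; exact: deg_le_incident.
under eq_bigr => x _ do rewrite -sum1dep_card big_mkcondr /=.
rewrite exchange_big /= mulnC -sum_nat_const; apply: leq_sum => f fD.
have := subsetP DK _ fD; rewrite inE => /eqP <-.
by rewrite -big_mkcond /= sum1_card.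
Qed.

Lemma degU U B D x : (deg U (B :|: D) x <= deg U B x + deg U D x)%N.
Proof.
apply: leq_trans (leq_card_setU _ _); apply/subset_leq_card/subsetP=> y.
by rewrite !inE => /andP[-> /orP[]->]; rewrite ?orbT.
Qed.

Lemma degS U B B' x : B \subset B' -> (deg U B x <= deg U B' x)%N.
Proof.
move=> BB'; apply/subset_leq_card/subsetP=> y; rewrite !inE => /andP[->].
by move/(subsetP BB').
Qed.

Variables (R : realType) (b : nat).
Hypothesis b0 : (0 < b)%N.
Let lam := growth_rate R b.

Lemma weight_ge1 d : 1 <= lam ^+ d.
Proof. exact/exprn_ege1/growth_rate_ge1. Qed.

Lemma weight_ge0 d : 0 <= lam ^+ d.
Proof. exact: le_trans (weight_ge1 d). Qed.

Lemma weight_breaker_move U B D x : D \subset Kn_edges n -> (#|D| <= b)%N ->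
  lam ^+ deg U (B :|: D) x <= lam ^+ deg U B x * (1 + (deg U D x)%:R / (32 * b%:R)).
Proof.
move=> DK Db; have db : (deg U D x <= b)%N by exact: leq_trans (deg_le_card U x DK) Db.
apply: le_trans (_ : lam ^+ (deg U B x + deg U D x) <= _).
  by rewrite ler_weXn2l ?growth_rate_ge1 // degU.
rewrite exprD ler_wpM2l ?weight_ge0 //.
by rewrite -lerBlDl growth_rate_sub1.
Qed.

Lemma weight_breaker_move2 U B D x : D \subset Kn_edges n -> (#|D| <= b)%N ->
  lam ^+ deg U (B :|: D) x <= 2 * lam ^+ deg U B x.
Proof.
move=> DK Db; have db : (deg U D x <= b)%N by exact: leq_trans (deg_le_card U x DK) Db.
apply: le_trans (_ : lam ^+ (deg U B x + b) <= _).
  by rewrite ler_weXn2l ?growth_rate_ge1 // (leq_trans (degU _ _ _ _)) // leq_add2l.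
by rewrite exprD mulrC ler_wpM2r ?weight_ge0 // growth_rate_pow_b.
Qed.

(** The increase at x is at most its term times deg_D(x) / (32b), and the degrees of [D] sum to at
    most 2b, whence 1/16. The pairing phase takes [r] constantly 1; the endgame takes [rho] = 16, so
    that a move costs just one maximal weight. *)
Lemma sum_weight_breaker_move U B D (r : 'I_n -> nat) rho W :
  D \subset Kn_edges n -> (#|D| <= b)%N -> 0 <= W ->
  (forall x, x \in U -> (r x <= rho)%N) ->
  (forall x, x \in U -> (0 < r x)%N -> lam ^+ deg U B x <= W) ->
  \sum_(x in U) (r x)%:R * lam ^+ deg U (B :|: D) x <=
  \sum_(x in U) (r x)%:R * lam ^+ deg U B x + rho%:R * W / 16.
Proof.
move=> DK Db W0 r_rho rW; have b0R : 0 < b%:R :> R by rewrite ltr0n.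
apply: le_trans (_ : \sum_(x in U) ((r x)%:R * lam ^+ deg U B x +
    rho%:R * W / (32 * b%:R) * (deg U D x)%:R) <= _).
  apply: ler_sum => x xU.
  apply: le_trans (_ : (r x)%:R * (lam ^+ deg U B x * (1 + (deg U D x)%:R / (32 * b%:R))) <= _).
    by rewrite ler_wpM2l // weight_breaker_move.
  rewrite mulrA mulrDr mulr1 lerD2l.
  have -> : rho%:R * W / (32 * b%:R) * (deg U D x)%:R =
      rho%:R * W * ((deg U D x)%:R / (32 * b%:R)) by rewrite mulrAC mulrA.
  apply: ler_wpM2r; first by rewrite divr_ge0 // mulr_ge0.
  have [->|rx] := posnP (r x); first by rewrite mul0r mulr_ge0.
  by rewrite ler_pM ?weight_ge0 ?ler_nat ?r_rho // rW.
rewrite big_split /= -mulr_sumr lerD2l -natr_sum.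
apply: le_trans (_ : rho%:R * W / (32 * b%:R) * (2 * b%:R) <= _).
  rewrite ler_wpM2l ?divr_ge0 ?mulr_ge0 // -natrM ler_nat.
  by apply: leq_trans (sum_deg_le U DK) _; rewrite leq_mul2l.
by rewrite le_eqVlt; apply/orP; left; apply/eqP; field; rewrite gt_eqF.
Qed.

End Degrees.

(** * The endgame *)

Section Endgame.

Variables (R : realType) (n : nat) (A B : {set 'I_n}) (h : nat).
Hypotheses (disjAB : [disjoint A & B]) (cardA : #|A| = h.*2) (cardB : #|B| = h.*2).
Hypothesis h0 : (0 < h)%N.
Implicit Types (M Bk D : {set {set 'I_n}}) (r : 'I_n -> nat).

Let U := A :|: B.
Let N := h.*2.
Let crit := critical_pairs A B h.
Let side := other_side A B.

Let N0R : 0 < N%:R :> R. Proof. by rewrite ltr0n double_gt0. Qed.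

(* If every v still has to receive r v edges to nearly uniformly random vertices
   of the other side, this bounds the expected number of critical pairs that
   are confined in the end. *)
Definition hall_potential M r : R :=
  \sum_(P in crit) (confined A B M P)%:R *
    \prod_(v in P.1) confinement_rate R N #|P.1| ^+ r v.

Lemma confinement_rate_ge0 s : 0 <= confinement_rate R N s.
Proof. by rewrite divr_ge0 // mulr_ge0. Qed.

Lemma rate_prod_ge0 (S : {set 'I_n}) s r :
  0 <= \prod_(v in S) confinement_rate R N s ^+ r v.
Proof. by apply: prodr_ge0 => v _; rewrite exprn_ge0 // confinement_rate_ge0. Qed.

Definition level_pairs (X Y : {set 'I_n}) s : {set {set 'I_n} * {set 'I_n}} :=
  [set P : {set 'I_n} * {set 'I_n} |
    [&& P.1 \subset X, #|P.1| == s, P.2 \subset Y & #|P.2| == s]].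

Lemma card_level_pairs (X Y : {set 'I_n}) s :
  #|level_pairs X Y s| = ('C(#|X|, s) * 'C(#|Y|, s))%N.
Proof.
rewrite -!cards_draws -cardsX.
by apply: eq_card => -[S T]; rewrite !inE /= -!andbA.
Qed.

(** Union bound for one orientation of the pairs, grouped by their common size s: there are C(N,s)^2
    of each size. *)
Lemma one_sided_init (X Y : {set 'I_n}) : #|X| = N -> #|Y| = N ->
  \sum_(P : {set 'I_n} * {set 'I_n} |
      [&& P.1 \subset X, P.2 \subset Y, #|P.1| == #|P.2|, (0 < #|P.1|)%N & (#|P.1| <= h)%N])
    confinement_rate R N #|P.1| ^+ (16 * #|P.1|) < 2^-1.
Proof.
move=> cX cY; apply: le_lt_trans (sum_confinement_lt R h0).
rewrite big_add1 /= big_mkord.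
have w0 s : 0 <= confinement_rate R N s ^+ (16 * s).
  by rewrite exprn_ge0 // confinement_rate_ge0.
rewrite [leRHS](eq_bigr (fun i : 'I_h => \sum_(P : {set 'I_n} * {set 'I_n})
   if P \in level_pairs X Y i.+1
   then confinement_rate R N #|P.1| ^+ (16 * #|P.1|) else 0)); last first.
  move=> i _; rewrite -big_mkcond /=.
  rewrite (eq_bigr (fun=> confinement_rate R N i.+1 ^+ (16 * i.+1))); last first.
    by move=> P; rewrite inE => /and4P[_ /eqP-> _ _].
  by rewrite sumr_const card_level_pairs cX cY -[RHS]mulr_natl natrM.
rewrite exchange_big big_mkcond /=; apply: ler_sum => P _.
case: ifP => [/and5P[PX PY /eqP PP P0 Ph]|_]; last first.
  by apply: sumr_ge0 => i _; case: ifP.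
have Ph' : (#|P.1|.-1 < h)%N by rewrite prednK.
rewrite (bigD1 (Ordinal Ph')) //= prednK // inE PX PY -PP eqxx /= lerDl sumr_ge0 // => i _.
by case: ifP.
Qed.

Lemma hall_potential_init M : hall_potential M (fun=> 16%N) < 1.
Proof.
have -> : 1 = 2^-1 + 2^-1 :> R by lra.
apply: le_lt_trans (ltrD (one_sided_init cardA cardB) (one_sided_init cardB cardA)).
rewrite /hall_potential big_mkcond [X in _ <= X + _]big_mkcond [X in _ <= _ + X]big_mkcond.
rewrite -big_split /=; apply: ler_sum => P _; rewrite inE.
have w0 : 0 <= confinement_rate R N #|P.1| ^+ (16 * #|P.1|).
  by rewrite exprn_ge0 // confinement_rate_ge0.
rewrite prodr_const -exprM; case: (confined _ _ _ _); last first.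
  by rewrite mul0r if_same addr_ge0 //; case: ifP.
rewrite mul1r; case: (#|P.1| == #|P.2|); case: (0 < #|P.1|)%N; case: (#|P.1| <= h)%N;
  rewrite ?andbF ?andbT ?addr0 //=.
by case: andP => _; case: andP => _ /=; rewrite ?addr0 ?add0r ?lerDl.
Qed.

(** Averaging over [X]. A confined pair with v in its first set survives only if y lies in its
    second set, a fraction at most s / #|X| <= 4s / (3N) of the choices; this is the factor released
    by lowering [r v]. Any other pair keeps its product, and new edges never confine it. *)
Lemma hall_step M r v (X : {set 'I_n}) :
  v \in U -> (0 < r v)%N -> X \subset side v -> (3 * N <= 4 * #|X|)%N ->
  exists2 y, y \in X &
    hall_potential ([set v; y] |: M) (fun x => r x - (x == v))%N <= hall_potential M r.
Proof.
move=> vU rv Xv NX; pose r' x := (r x - (x == v))%N; rewrite -/r'.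
have X0 : (0 < #|X|)%N by move: h0 NX; rewrite /N; lia.
have X0R : 0 < #|X|%:R :> R by rewrite ltr0n.
have mono (P : {set 'I_n} * {set 'I_n}) y : confined A B ([set v; y] |: M) P -> confined A B M P.
  move=> /forall_inP c; apply/forall_inP=> x xP; apply/forall_inP=> z zx.
  by apply/implyP=> e; have /forall_inP/(_ _ zx)/implyP := c _ xP; apply; rewrite inE e orbT.
have kill (P : {set 'I_n} * {set 'I_n}) y :
    y \in X -> v \in P.1 -> confined A B ([set v; y] |: M) P -> y \in P.2.
  move=> yX vP /forall_inP/(_ _ vP)/forall_inP/(_ y (subsetP Xv _ yX))/implyP.
  by apply; rewrite setU11.
suff le_sum : \sum_(y in X) hall_potential ([set v; y] |: M) r' <= #|X|%:R * hall_potential M r.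
  apply/exists_inP; apply: contraTT le_sum => /exists_inPn no; rewrite -ltNge.
  rewrite mulr_natl -sumr_const; apply: ltr_sum => [|y yX].
    by have /card_gt0P[y yX] := X0; apply/hasP; exists y; rewrite ?mem_index_enum.
  by rewrite ltNge; exact: no.
rewrite exchange_big /= mulr_sumr; apply: ler_sum => P Pc.
have sE : \sum_(y in X) (confined A B ([set v; y] |: M) P)%:R <=
          (confined A B M P)%:R * (if v \in P.1 then #|P.2| else #|X|)%:R :> R.
  rewrite -natr_sum -natrM ler_nat.
  have [c|/negPf nc] := boolP (confined A B M P); last first.
    rewrite big1 // => y _; case: (boolP (confined _ _ _ _)) => // /mono.
    by rewrite nc.
  rewrite mul1n; case: ifP => vP; last first.
    by rewrite -sum1_card; apply: leq_sum => y _; exact: leq_b1.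
  rewrite -sum1_card big_mkcond [leqRHS]big_mkcond; apply: leq_sum => y _.
  by case: ifP => // yX; case: (boolP (confined _ _ _ _)) => //= /(kill _ _ yX vP)->.
rewrite -mulr_suml; apply: le_trans (ler_wpM2r (rate_prod_ge0 _ _ _) sE) _.
rewrite -mulrA [leRHS]mulrCA; apply: ler_wpM2l => //.
case: ifP => vP; last first.
  rewrite mulrC [leRHS]mulrC ler_wpM2r // ler_prod // => x xP.
  rewrite exprn_ge0 ?confinement_rate_ge0 //= /r'.
  by case: eqP xP => [->|_ _]; [rewrite vP | rewrite subn0].
rewrite (bigD1 v) //= [X in _ <= _ * X](bigD1 v) //=.
rewrite [X in _ * (_ * X)](_ : _ =
    \prod_(i in P.1 | i != v) confinement_rate R N #|P.1| ^+ r i); last first.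
  by apply: eq_bigr => x /andP[_ /negPf xv]; rewrite /r' xv subn0.
rewrite !mulrA; apply: ler_wpM2r.
  by apply: prodr_ge0 => x _; rewrite exprn_ge0 // confinement_rate_ge0.
have -> : r v = (r' v).+1 by rewrite /r' eqxx subn1 prednK.
rewrite exprS mulrA ler_wpM2r ?exprn_ge0 ?confinement_rate_ge0 //.
move: Pc; rewrite inE => /and4P[_ /eqP <- _ _].
rewrite /confinement_rate mulrA ler_pdivlMr ?mulr_gt0 //.
have : (3 * N * #|P.1| <= 4 * #|X| * #|P.1|)%N by rewrite leq_mul2r NX orbT.
rewrite -(ler_nat R) !natrM; move: N%:R #|P.1|%:R #|X|%:R => x y z; lra.
Qed.

(** With no request left every product equals 1, so a single confined pair would already contribute
    1. *)
Lemma hall_end M r : hall_potential M r < 1 -> (forall v, v \in U -> r v = 0%N) ->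
  forall P, P \in crit -> ~~ confined A B M P.
Proof.
move=> lt1 r0 P Pc; apply/negP=> c; move: lt1; rewrite ltNge => /negP[].
rewrite /hall_potential (bigD1 P) //= c mul1r big1 => [|v vP].
  rewrite lerDl sumr_ge0 // => Q _; rewrite mulr_ge0 ?rate_prod_ge0 //.
rewrite r0 ?expr0 // inE; move: Pc; rewrite inE => /and4P[+ _ _ _].
by case/orP=> /andP[/subsetP s _]; rewrite s ?orbT.
Qed.

(** * Serving the requests against Breaker's degrees *)

Variables (b L : nat).
Hypotheses (b0 : (0 < b)%N) (L0 : (0 < L)%N) (bL : (b < 2 ^ L)%N)
  (NL : (100 * 256 * b * L <= N)%N).
Let lam := growth_rate R b.

Definition box_potential Bk r : R := \sum_(v in U) (r v)%:R * lam ^+ deg U Bk v.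

Lemma side_sub v : v \in U -> side v \subset U.
Proof.
by move=> _; rewrite /side /other_side; case: ifP => _; rewrite ?subsetUr ?subsetUl.
Qed.

Lemma card_side v : #|side v| = N.
Proof. by rewrite /side /other_side; case: ifP. Qed.

Lemma notin_side v : v \in U -> v \notin side v.
Proof.
rewrite inE => /orP[vA|vB].
  by rewrite /side other_sideA // (disjointFr disjAB).
by rewrite /side (other_sideB disjAB) // (disjointFl disjAB).
Qed.

Lemma box_potential_ge v Bk r : v \in U -> (0 < r v)%N ->
  lam ^+ deg U Bk v <= box_potential Bk r.
Proof.
move=> vU rv; rewrite /box_potential (bigD1 v) //=.
apply: le_trans (_ : (r v)%:R * lam ^+ deg U Bk v <= _).
  by rewrite ler_peMl ?weight_ge0 // ler1n.
by rewrite lerDl sumr_ge0 // => x _; rewrite mulr_ge0 ?weight_ge0.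
Qed.

Let F := perfect_matchings n.
Let X := Kn_edges n.

(** Maker's turn is a hypothesis so that both its own induction and the start of the endgame can use
    this step. Breaker at most doubles a weight, and adds at most one maximal weight to the
    potential because 16/16 = 1. *)
Lemma endgame_breaker_turn t :
  (forall M Bk r, (\sum_(v in U) r v)%N = t -> (forall v, v \in U -> r v <= 16)%N ->
     matched M (~: U) -> Bk \subset X ->
     hall_potential M r < 1 ->
     (forall v, v \in U -> (0 < r v)%N -> lam ^+ deg U Bk v <= 128 * N%:R) ->
     (forall v, v \in U -> (0 < r v)%N ->
        (forall x, x \in U -> (0 < r x)%N -> (deg U Bk x <= deg U Bk v)%N) ->
        box_potential Bk r <= 64 * N%:R + lam ^+ deg U Bk v) ->
     maker_to_move_wins X b F t M Bk) ->
  forall M Bk r, (\sum_(v in U) r v)%N = t -> (forall v, v \in U -> r v <= 16)%N ->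
     matched M (~: U) -> Bk \subset X -> hall_potential M r < 1 ->
     box_potential Bk r <= 64 * N%:R -> maker_wins X b F t.+1 M Bk.
Proof.
move=> maker_turn M Bk r rt r16 mM BkX hp bp.
apply: maker_winsS => D DX Db.
have DK : D \subset X by exact: subset_trans DX (subsetDl _ _).
apply: (maker_turn _ _ r) => //.
- by rewrite subUset BkX.
- move=> v vU rv; apply: le_trans (weight_breaker_move2 R b0 U Bk v DK Db) _.
  have -> : 128 * N%:R = 2 * (64 * N%:R) :> R by move: N%:R => x; lra.
  by rewrite ler_wpM2l // (le_trans (box_potential_ge Bk vU rv)).
move=> v vU rv vmax; apply: le_trans (lerD bp (lexx _)).
apply: le_trans (sum_weight_breaker_move (W := lam ^+ deg U (Bk :|: D) v) b0 DK Db _ r16 _) _.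
- exact: weight_ge0.
- move=> x xU rx; rewrite ler_weXn2l ?growth_rate_ge1 //.
  by apply: leq_trans (vmax x xU rx); rewrite degS // subsetUl.
- by rewrite lerD2l mulrAC divff ?mul1r // pnatr_eq0.
Qed.

(** Serving a vertex of maximal degree among those with open requests removes one maximal weight,
    which brings [box_potential] back to 64N. *)
Lemma endgame_maker_turn t M Bk r :
  (\sum_(v in U) r v)%N = t -> (forall v, v \in U -> r v <= 16)%N ->
  matched M (~: U) -> Bk \subset X -> hall_potential M r < 1 ->
  (forall v, v \in U -> (0 < r v)%N -> lam ^+ deg U Bk v <= 128 * N%:R) ->
  (forall v, v \in U -> (0 < r v)%N ->
     (forall x, x \in U -> (0 < r x)%N -> (deg U Bk x <= deg U Bk v)%N) ->
     box_potential Bk r <= 64 * N%:R + lam ^+ deg U Bk v) ->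
  maker_to_move_wins X b F t M Bk.
Proof.
elim: t M Bk r => [|t IH] M Bk r rt r16 mM BkX hp wb bp.
  apply/orP; left; apply: has_won_matched.
  apply: (not_confined_matched disjAB cardA cardB _ mM) => P.
  apply: (hall_end hp) => v vU; apply/eqP; rewrite -leqn0 -rt.
  by rewrite (bigD1 v) //=; exact: leq_addr.
have [v0 v0U] : exists v, v \in [set v in U | (0 < r v)%N].
  apply/set0Pn; apply/eqP=> e; suff : (\sum_(v in U) r v = 0)%N by rewrite rt.
  apply: big1 => v vU; apply/eqP; rewrite -leqn0 leqNgt; apply/negP=> rv.
  by have := in_set0 v; rewrite -e inE vU rv.
have [v] := exists_max_in (deg U Bk) v0U; rewrite inE => /andP[vU rv] vmax'.
have vmax x : x \in U -> (0 < r x)%N -> (deg U Bk x <= deg U Bk v)%N.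
  by move=> xU rx; apply: vmax'; rewrite inE xU.
have degv : (4 * deg U Bk v <= N)%N.
  exact: (growth_rate_degree b0 bL L0 NL (wb v vU rv)).
have cY : (3 * N <= 4 * #|side v :\: nbrs U Bk v|)%N.
  have : (#|side v :&: nbrs U Bk v| <= deg U Bk v)%N by exact/subset_leq_card/subsetIr.
  by rewrite cardsD card_side; lia.
have [y] := hall_step M vU rv (subsetDl _ _) cY.
rewrite in_setD => /andP[ynb ys]; pose r' x := (r x - (x == v))%N; rewrite -/r' => hp'.
have yU := subsetP (side_sub vU) _ ys.
have vy : v != y by apply: contraTneq ys => <-; exact: notin_side.
have eBk : [set v; y] \notin Bk by move: ynb; rewrite inE yU.
have r'r x : (r' x <= r x)%N by exact: leq_subr.
have rt' : (\sum_(x in U) r' x)%N = t.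
  move: rt; rewrite (bigD1 v) //= => rt; rewrite (bigD1 v) //= /r' eqxx.
  have -> : (\sum_(i in U | i != v) (r i - (i == v)) = \sum_(i in U | i != v) r i)%N.
    by apply: eq_bigr => x /andP[_ /negPf->]; rewrite subn0.
  by apply/eqP; rewrite subn1 -eqSS -rt -addSn prednK.
have hp1 : hall_potential ([set v; y] |: M) r' < 1 by exact: le_lt_trans hp' hp.
have r'16 x : x \in U -> (r' x <= 16)%N by move=> xU; exact: leq_trans (r'r x) (r16 x xU).
have bp' : box_potential Bk r' <= 64 * N%:R.
  have := bp v vU rv vmax; rewrite /box_potential (bigD1 v) //= [in X in _ -> X](bigD1 v) //=.
  have -> : \sum_(i in U | i != v) (r' i)%:R * lam ^+ deg U Bk i =
            \sum_(i in U | i != v) (r i)%:R * lam ^+ deg U Bk i.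
    by apply: eq_bigr => x /andP[_ /negPf xv]; rewrite /r' xv subn0.
  by rewrite /r' eqxx natrB // mulrBl mul1r addrAC lerBlDr.
(* The edge may already be Maker's, for instance claimed from its other end. Then the request is
   served without a move and Maker is still to move. *)
have [eM|eM] := boolP ([set v; y] \in M).
  apply: (maker_to_move_wins_leq (leqnSn t)); apply: (IH _ _ r') => //.
  - by move: hp1; rewrite (setUidPr _) // sub1set.
  - by move=> x xU r'x; apply: wb => //; exact: leq_trans (r'r x).
  - by move=> x xU r'x _; apply: le_trans bp' _; rewrite lerDl weight_ge0.
apply/orP; right; apply/exists_inP; exists [set v; y].
  by rewrite inE inE negb_or eM eBk in_Kn.
apply: (endgame_breaker_turn IH rt' r'16) => //.
by apply: matchedS mM; exact: subsetUr.
Qed.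

(** The 2N vertices make 16 requests each, and 16 * 4N = 64N. The spare move is there because the
    win is noticed only on Maker's next turn. *)
Lemma endgame M Bk : matched M (~: U) -> Bk \subset X ->
  \sum_(v in U) lam ^+ deg U Bk v <= 4 * N%:R ->
  maker_wins X b F (32 * N).+1 M Bk.
Proof.
move=> mM BkX bp; have cardU : #|U| = (2 * N)%N.
  by rewrite cardsU disjoint_setI0 // cards0 subn0 cardA cardB mul2n addnn.
have rt : (\sum_(v in U) 16 = 32 * N)%N by rewrite sum_nat_const cardU; lia.
apply: (endgame_breaker_turn (@endgame_maker_turn _) rt) => //.
  exact: hall_potential_init.
by rewrite /box_potential -mulr_sumr (_ : 64 = 16 * 4 :> R) -?mulrA ?ler_wpM2l //; lra.
Qed.

End Endgame.

(** * The pairing phase *)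

(** Here u is the number of vertices, a the average excess of the weights over 1, m the largest
    weight and s the score of the second vertex. If a >= 1, then m >= 2 and s >= 15/8 pay for the
    move; if a < 1, the potential u + ua is itself low enough. *)
Lemma potential_drop (F : realFieldType) (phi u a m s : F) : 3 <= u ->
  phi <= 2 * u + m / 16 -> phi = u + u * a -> 1 + a <= m -> 2 * a - 8^-1 <= s ->
  phi - m - 1 - s <= 2 * (u - 2).
Proof.
move=> u3 phi_le phiE am sa; have [a1|a1] := lerP 1 a; first by lra.
have : 0 <= (1 - a) * (u - 3) by rewrite mulr_ge0 // subr_ge0 // ltW.
by lra.
Qed.

Section Pairing.

Variables (R : realType) (n b L : nat).
Hypotheses (b0 : (0 < b)%N) (L0 : (0 < L)%N) (bL : (b < 2 ^ L)%N).
Implicit Types (M Bk D : {set {set 'I_n}}) (U : {set 'I_n}).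
Let lam := growth_rate R b.

Let lam0 : 0 < lam. Proof. exact: growth_rate_gt0. Qed.
Let lam1 : 1 <= lam. Proof. exact: growth_rate_ge1. Qed.
Let b0R : 0 < b%:R :> R. Proof. by rewrite ltr0n. Qed.

(** * The effect of deleting a pair on the potential *)

Section Score.

Variables (U : {set 'I_n}) (Bk : {set {set 'I_n}}).
Hypothesis BkK : Bk \subset Kn_edges n.
Let W x := lam ^+ deg U Bk x.
Let c := 1 - lam^-1.

Let c0 : 0 <= c. Proof. by rewrite subr_ge0 invf_le1. Qed.

Let W1 x : 1 <= W x. Proof. exact: weight_ge1. Qed.
Let W0 x : 0 <= W x. Proof. exact: le_trans (W1 x). Qed.

(* How much the potential, not counting the 1 that every vertex contributes,
   drops when w is removed from U. *)
Definition score w : R := W w - 1 + \sum_(x in nbrs U Bk w) c * W x.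

Lemma score_ge0 w : 0 <= score w.
Proof.
by rewrite addr_ge0 ?subr_ge0 // sumr_ge0 // => x _; rewrite mulr_ge0.
Qed.

(** Double counting: x yields its excess once for itself, and once more through its deg(x)
    neighbours, by [expr_sub1_le]. *)
Lemma sum_score : 2 * (\sum_(x in U) (W x - 1)) <= \sum_(w in U) score w.
Proof.
rewrite [leRHS]big_split /= mulr_natl mulr2n lerD2l.
have -> : \sum_(w in U) \sum_(x in nbrs U Bk w) c * W x =
          \sum_(w in U) \sum_(x in U) if x \in nbrs U Bk w then c * W x else 0.
  apply: eq_bigr => w _; rewrite -big_mkcondr /=; apply: eq_bigl => x.
  by rewrite !inE; case: (x \in U).
rewrite exchange_big /=; apply: ler_sum => x xU.
rewrite -big_mkcondr /= (eq_bigl (mem (nbrs U Bk x))); last first.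
  move=> w /=; have [wU|/negPf wU] := boolP (w \in U); first by rewrite nbrs_sym.
  by rewrite [RHS]inE wU.
rewrite sumr_const -mulr_natl mulrA; exact: expr_sub1_le.
Qed.

(** Each neighbour x of w loses at least one degree, hence at least c * W x. As w is not adjacent to
    v, no such loss is credited at v. *)
Lemma remove_pair v w : v \in U -> w \in U -> v != w -> w \notin nbrs U Bk v ->
  \sum_(x in U :\: [set v; w]) lam ^+ deg (U :\: [set v; w]) Bk x <=
  \sum_(x in U) W x - W v - 1 - score w.
Proof.
move=> vU wU vw nvw; set U' := U :\: _.
have U'U : U' \subset U by exact: subsetDl.
have drop x : x \in U' -> lam ^+ deg U' Bk x <= W x - if x \in nbrs U Bk w then c * W x else 0.
  move=> xU'; have xU := subsetP U'U _ xU'.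
  have sub : nbrs U' Bk x \subset nbrs U Bk x.
    by apply/subsetP=> y; rewrite !inE -!andbA => /and3P[_ -> ->].
  case: ifP => xw; last by rewrite subr0 ler_weXn2l // subset_leq_card.
  have lt_deg : (deg U' Bk x < deg U Bk x)%N.
    apply/proper_card/properP; split=> //; exists w.
      by rewrite nbrs_sym.
    by rewrite !inE eqxx orbT.
  have -> : W x - c * W x = lam ^+ (deg U Bk x).-1.
    rewrite /c mulrBl mul1r opprB addrC subrK /W -{1}(prednK (leq_ltn_trans (leq0n _) lt_deg)).
    by rewrite exprS mulKf // gt_eqF.
  by rewrite ler_weXn2l // -ltnS prednK // (leq_ltn_trans _ lt_deg).
apply: le_trans (ler_sum _ drop) _.
rewrite sumrB -big_mkcondr /=.
have -> : \sum_(i in U' | i \in nbrs U Bk w) c * W i = \sum_(i in nbrs U Bk w) c * W i.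
  apply: eq_bigl => x; apply: andb_idl => xw; rewrite in_setD !inE negb_or.
  have xU : x \in U by move: xw; rewrite inE => /andP[].
  rewrite xU andbT; apply/andP; split; apply/negP=> /eqP e.
    by move: nvw; rewrite nbrs_sym // -e xw.
  by move: xw; rewrite e (negPf (nbrs_irr _ _ BkK)).
have -> : \sum_(x in U) W x = W v + (W w + \sum_(x in U') W x).
  rewrite (bigD1 v) //= (bigD1 w) /=; last by rewrite wU eq_sym.
  congr (_ + (_ + _)); apply: eq_bigl => x; rewrite !inE negb_or.
  by case: (x \in U); rewrite ?andbF ?andbT.
rewrite /score; set X1 := \sum_(i in U') _; set X2 := \sum_(i in nbrs _ _ _) _.
by move: (W v) (W w) X1 X2 => *; lra.
Qed.

End Score.

Lemma pairing_step U Bk D :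
  Bk \subset Kn_edges n -> D \subset Kn_edges n -> (#|D| <= b)%N ->
  (100 * 256 * b * L <= #|U|)%N ->
  \sum_(x in U) lam ^+ deg U Bk x <= 2 * #|U|%:R ->
  exists v w, [/\ v \in U, w \in U, v != w, [set v; w] \notin Bk :|: D &
    \sum_(x in U :\: [set v; w]) lam ^+ deg (U :\: [set v; w]) (Bk :|: D) x
      <= 2 * (#|U|%:R - 2)].
Proof.
move=> BkK DK Db UL Phi0; set Bk' := Bk :|: D.
have Bk'K : Bk' \subset Kn_edges n by rewrite subUset BkK.
have u24 : (100 * 240 * b <= #|U|)%N.
  by have := leq_pmulr b L0; move: UL; rewrite -mulnA; move: (b * L)%N #|U|; lia.
have u0 : (0 < #|U|)%N by move: u24 b0; clear; lia.
have /card_gt0P[v0 v0U] := u0.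
have u0R : 0 < #|U|%:R :> R by rewrite ltr0n.
have [v vU vmax] := exists_max_in (deg U Bk') v0U.
pose W x := lam ^+ deg U Bk' x; pose m := W v.
have W0 x : 0 <= W x by exact: weight_ge0.
have W1 x : 1 <= W x by exact: weight_ge1.
have Wm x : x \in U -> W x <= m by move=> xU; rewrite ler_weXn2l // vmax.
have single x : x \in U -> lam ^+ deg U Bk x <= 2 * #|U|%:R.
  move=> xU; apply: le_trans Phi0; rewrite (bigD1 x) //= lerDl.
  by apply: sumr_ge0 => y _; exact: weight_ge0.
have degv : (4 * deg U Bk' v <= #|U|)%N.
  apply: (growth_rate_degree (R := R) b0 bL L0 UL).
  apply: le_trans (weight_breaker_move2 R b0 U Bk v DK Db) _.
  by move: (single v vU) u0R; rewrite -/lam; move: (lam ^+ _) (#|U|%:R) => x y; lra.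
pose rest := U :\: (v |: nbrs U Bk' v).
have restP w : w \in rest -> [/\ w \in U, v != w & w \notin nbrs U Bk' v].
  by rewrite in_setD in_setU1 negb_or eq_sym => /andP[/andP[-> ->] ->].
have notBk w : w \in rest -> [set v; w] \notin Bk'.
  by move=> /restP[wU _]; rewrite inE wU.
have card_nv : (#|v |: nbrs U Bk' v| <= (deg U Bk' v).+1)%N.
  by rewrite cardsU1 -add1n leq_add2r leq_b1.
have /card_gt0P[w0 w0r] : (0 < #|rest|)%N.
  have : (#|U :&: (v |: nbrs U Bk' v)| <= (deg U Bk' v).+1)%N.
    exact: leq_trans (subset_leq_card (subsetIr _ _)) card_nv.
  rewrite cardsD; move: (deg _ _ _) degv #|_ :&: _| u24 b0; clear; lia.
have Phi1 : \sum_(x in U) W x <= 2 * #|U|%:R + m / 16.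
  have E B' : \sum_(x in U) 1%:R * growth_rate R b ^+ deg U B' x =
      \sum_(x in U) lam ^+ deg U B' x by apply: eq_bigr => x _; rewrite mul1r.
  have := sum_weight_breaker_move (r := fun=> 1%N) (rho := 1) (W := m) b0 DK Db (W0 v).
  move=> /(_ U Bk (fun _ _ => isT)).
  rewrite !E mul1r => H; apply: le_trans (H _) _.
    by move=> x xU _; apply: le_trans (Wm x xU); rewrite ler_weXn2l // degS // subsetUl.
  by rewrite lerD2r.
(* If m >= 4, the vertex v pays alone: m - m/16 + 1 >= 4, and any non-neighbour serves as w. *)
have [m4|m4] := lerP 4 m.
  have [w0U vw0 nvw0] := restP _ w0r.
  exists v, w0; split=> //; first exact: notBk.
  apply: le_trans (remove_pair Bk'K vU w0U vw0 nvw0) _.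
  have := score_ge0 U Bk' w0; move: (score _ _ _) Phi1 m4; rewrite -/lam -/(W _) -/m.
  by move: (\sum_(x in U) _) (m) (#|U|%:R) => x y z t; lra.
(* For m < 4, Bernoulli gives 1 + d/(64b) <= 4. Scores are then at most 3 + 192b * 4/(64b) = 15. *)
have degb x : x \in U -> (deg U Bk' x)%:R <= 192 * b%:R :> R.
  move=> xU; have := bernoulli (deg U Bk' x) (x := (64 * b%:R)^-1 : R).
  rewrite invr_ge0 mulr_ge0 // => /(_ isT) h.
  have {h} : 1 + (deg U Bk' x)%:R / (64 * b%:R) <= 4 :> R.
    by apply: le_trans h _; apply: le_trans (Wm x xU) _; exact: ltW.
  rewrite -lerBrDl ler_pdivrMr ?mulr_gt0 //; move/le_trans; apply.
  by rewrite mulrA ler_wpM2r //; lra.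
have score15 x : x \in U -> score U Bk' x <= 15.
  move=> xU; rewrite /score.
  have : \sum_(y in nbrs U Bk' x) (1 - lam^-1) * W y <= 12.
    apply: le_trans (_ : \sum_(y in nbrs U Bk' x) (64 * b%:R)^-1 * 4 <= _).
      apply: ler_sum => y; rewrite inE => /andP[yU _].
      apply: ler_pM => //; [by rewrite subr_ge0 invf_le1 | exact: growth_rate_inv|].
      by apply: le_trans (Wm y yU) _; exact: ltW.
    rewrite sumr_const -[leLHS]mulr_natl -/(deg _ _ _).
    apply: le_trans (ler_wpM2r _ (degb x xU)) _.
      by rewrite mulr_ge0 ?invr_ge0 ?mulr_ge0.
    rewrite le_eqVlt; apply/orP; left; apply/eqP; field; exact: lt0r_neq0.
  have := Wm x xU; rewrite -/(W _).
  by move: (W x) (\sum_(y in nbrs _ _ _) _) m4; move: (m) => y z t; lra.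
(* The forbidden choices of w have total score at most 15(192b + 1), below 3000b <= #|U|/8; this is
   the 1/8 lost in the average. *)
have sum_near : \sum_(x in v |: nbrs U Bk' v) score U Bk' x < #|U|%:R / 8.
  apply: le_lt_trans (_ : \sum_(x in v |: nbrs U Bk' v) 15 < _).
    apply: ler_sum => x; rewrite in_setU1 => /orP[/eqP->|]; first exact: score15.
    by rewrite inE => /andP[xU _]; exact: score15.
  rewrite sumr_const -[ltLHS]mulr_natl.
  have h1 : #|v |: nbrs U Bk' v|%:R <= 192 * b%:R + 1 :> R.
    apply: le_trans (_ : (deg U Bk' v).+1%:R <= _); first by rewrite ler_nat.
    by rewrite -natr1 lerD2r degb.
  have h2 : 100 * 240 * b%:R <= #|U|%:R :> R by rewrite -!natrM ler_nat.
  have h3 : 1 <= b%:R :> R by rewrite ler1n.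
  by move: h1 h2 h3; move: (#|_|%:R) (#|U|%:R) (b%:R) => x y z; lra.
have [a aE] : exists a : R, \sum_(x in U) W x = #|U|%:R + #|U|%:R * a.
  exists ((\sum_(x in U) W x) / #|U|%:R - 1).
  by rewrite mulrBr mulr1 mulrCA divff ?gt_eqF // mulr1 addrC subrK.
have am : 1 + a <= m.
  have : \sum_(x in U) W x <= #|U|%:R * m.
    by rewrite mulr_natl -sumr_const; apply: ler_sum => x; exact: Wm.
  by rewrite aE -[X in X + _]mulr1 -mulrDr ler_pM2l.
(* The scores average at least 2a over [U], and those outside [rest] account for less than 1/8 of
   this average. *)
have [w wr sw] : exists2 w, w \in rest & 2 * a - 8^-1 <= score U Bk' w.
  have [neg|pos] := lerP (2 * a - 8^-1) 0.
    by exists w0 => //; apply: le_trans neg _; exact: score_ge0.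
  apply/exists_inP; apply: contraT => /exists_inPn no.
  have := sum_score U Bk'; rewrite -/lam leNgt => /negP[].
  have -> : \sum_(x in U) (lam ^+ deg U Bk' x - 1) = #|U|%:R * a.
    by rewrite sumrB -/W aE sumr_const addrAC subrr add0r.
  rewrite (bigID (mem (v |: nbrs U Bk' v))) /=.
  rewrite (eq_bigl (mem (v |: nbrs U Bk' v))); last first.
    move=> x; apply: andb_idl; rewrite in_setU1 => /orP[/eqP->//|].
    by rewrite inE => /andP[].
  rewrite [X in _ + X](eq_bigl (mem rest)); last first.
    by move=> x; rewrite /= in_setD andbC.
  have : \sum_(x in rest) score U Bk' x <= #|U|%:R * (2 * a - 8^-1).
    apply: le_trans (_ : \sum_(x in rest) (2 * a - 8^-1) <= _).
      by apply: ler_sum => x xr; apply/ltW; rewrite ltNge; exact: no.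
    rewrite sumr_const -[leLHS]mulr_natl; apply: ler_wpM2r; first exact: ltW.
    by rewrite ler_nat; exact/subset_leq_card/subsetDl.
  move: sum_near; move: (\sum_(x in _) _) (\sum_(x in rest) _) => x y.
  by move: (#|U|%:R) => z; lra.
have [wU vw nvw] := restP _ wr.
exists v, w; split=> //; first exact: notBk.
apply: le_trans (remove_pair Bk'K vU wU vw nvw) _.
move: sw Phi1 aE am; rewrite -/lam -/(W _) -/m.
have h3 : 3 <= #|U|%:R :> R by rewrite ler_nat; move: u24 b0; clear; lia.
move=> sw Phi1' aE' am'; exact: potential_drop h3 Phi1' aE' am' sw.
Qed.

Variables (h : nat).
Hypotheses (h0 : (0 < h)%N) (hL : (100 * 256 * b * L <= h.*2)%N).
Let N := h.*2.

(** Here [j] is the number of pairs still to be made. The bound 2 * #|U| persists and becomes the 4N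
    required by the endgame; Maker's edges avoid [U], so every pair found inside [U] is new to
    him. *)
Lemma pairing_phase j U M Bk :
  #|U| = (2 * N + 2 * j)%N -> matched M (~: U) ->
  (forall e, e \in M -> [disjoint e & U]) -> Bk \subset Kn_edges n ->
  \sum_(x in U) lam ^+ deg U Bk x <= 2 * #|U|%:R ->
  maker_wins (Kn_edges n) b (perfect_matchings n) (j + (32 * N).+1) M Bk.
Proof.
elim: j U M Bk => [|j IH] U M Bk cU mM dM BkK Phi.
  have [|A AU cA] := @subset_of_card _ U N; first by rewrite cU; lia.
  have UE : U = A :|: (U :\: A) by rewrite -{1}(setID U A) (setIidPr AU).
  have cB : #|U :\: A| = N by rewrite cardsD (setIidPr AU) cU cA; lia.
  rewrite add0n; apply: (@endgame R _ A (U :\: A) h _ _ _ _ b L) => //.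
  - by rewrite disjoint_sym disjoints_subset; apply/subsetP=> x; rewrite !inE => /andP[].
  - by rewrite -UE.
  - by rewrite -UE; apply: le_trans Phi _; rewrite cU muln0 addn0 natrM mulrA -natrM.
apply: maker_winsS => D DX Db.
have DK : D \subset Kn_edges n by exact: subset_trans DX (subsetDl _ _).
have UL : (100 * 256 * b * L <= #|U|)%N.
  by rewrite cU mul2n -addnn -!addnA; exact: leq_trans hL (leq_addr _ _).
have [v [w [vU wU vw nB Phi']]] := pairing_step BkK DK Db UL Phi.
have cU' : #|U :\: [set v; w]| = (2 * N + 2 * j)%N.
  rewrite cardsD (setIidPr _) ?cards2 ?vw ?cU; first by move: (2 * N)%N; clear; lia.
  by rewrite subUset !sub1set vU.
apply/orP; right; apply/exists_inP; exists [set v; w].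
  rewrite inE inE negb_or nB in_Kn vw !andbT; apply/negP=> /dM /pred0P/(_ v).
  by rewrite /= !inE eqxx vU.
apply: (IH (U :\: [set v; w])) => //.
- rewrite setCD (setUC (~: U)); apply: matchedU2 => //; rewrite ?setU11 ?in_setC ?vU ?wU //.
  by apply: matchedS mM; exact: subsetUr.
- move=> e; rewrite in_setU1 => /orP[/eqP->|/dM].
    by rewrite disjoint_sym disjoints_subset; apply/subsetP=> x; rewrite !inE => /andP[].
  by move/disjointWr; apply; exact: subsetDl.
- by rewrite subUset BkK.
- apply: le_trans Phi' _; rewrite cU' cU ler_pM2l // lerBlDr -natrD ler_nat.
  by move: (2 * N)%N; clear; lia.
Qed.

End Pairing.

(** * Assembly and choice of the constants *)

Lemma maker_wins_perfect_matching (R : realType) (n b L : nat) :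
  (0 < b)%N -> (0 < L)%N -> (b < 2 ^ L)%N -> ~~ odd n ->
  (2 * (100 * 256 * b * L) <= n)%N ->
  maker_can_win_within (Kn_edges n) b (perfect_matchings n)
    (n./2 - 100 * 256 * b * L + (32 * (100 * 256 * b * L)).+1).
Proof.
move=> b0 L0 bL n_even nL.
apply: (maker_can_win_of_wins set0).
have hE : ((100 * 128 * b * L).*2 = 100 * 256 * b * L)%N by clear; lia.
have h0 : (0 < 100 * 128 * b * L)%N by rewrite !muln_gt0 b0 L0.
rewrite -hE; apply: (@pairing_phase R n b L b0 L0 bL _ h0 _ _ [set: 'I_n]) => //.
- exact: eq_leq (esym hE).
- rewrite cardsT card_ord hE; move: nL n_even; move: (100 * 256 * b * L)%N.
  by clear; lia.
- by rewrite setCT matched0.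
- by move=> e; rewrite inE.
- exact: sub0set.
(* On the empty board all degrees vanish, so the potential is n, within the allowed 2n. *)
rewrite mulr_natl mulr2n (eq_bigr (fun=> 1)) ?sumr_const ?lerDl // => x _.
by rewrite (_ : deg _ _ _ = 0%N) ?expr0 //; apply: eq_card0 => y; rewrite !inE.
Qed.

Lemma log_bound (R : realType) (b : nat) : (0 < b)%N ->
  (trunc_log 2 b).+1%:R * ln 2 <= 2 * ln (maxn b 2)%:R :> R.
Proof.
move=> b0; have m2 : (2 : R) <= (maxn b 2)%:R by rewrite ler_nat leq_maxr.
have h1 : ln 2 <= ln (maxn b 2)%:R :> R.
  by rewrite ler_ln ?posrE // (lt_le_trans _ m2).
have h2 : (trunc_log 2 b)%:R * ln 2 <= ln (maxn b 2)%:R :> R.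
  rewrite mulr_natl -lnXn // ler_ln ?posrE ?exprn_gt0 ?(lt_le_trans _ m2) //.
  by rewrite -natrX ler_nat (leq_trans (trunc_logP _ b0)) // leq_maxl.
by rewrite -natr1 mulrDl mul1r; lra.
Qed.

(* For b >= 2 the bound is n/2 + C b ln b.  For b = 1 that bound would be n/2,
   which is impossible: Breaker takes the last edge Maker needs.  Hence ln 2
   in place of ln 1 in that one case. *)
Theorem theorem1p1 (R : realType) :
  exists delta C : R, 0 < delta /\ 0 < C /\
  exists n0 : nat, forall n : nat, (n0 <= n)%N -> ~~ odd n ->
  forall b : nat, (0 < b)%N ->
    b%:R <= delta * n%:R / (100%:R * ln (n%:R : R)) ->
  exists m : nat,
    m%:R <= n%:R / 2%:R + C * b%:R * ln ((maxn b 2)%:R : R) /\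
    maker_can_win_within (Kn_edges n) b (perfect_matchings n) m.
Proof.
have ln2 : 0 < ln 2 :> R by rewrite ln_gt0 // ltr1n.
(* The endgame takes about 32N moves with N = 100 * 256 * b * L and L <= 2 ln(max(b,2)) / ln 2. *)
pose c : R := 32 * (100 * 256) * 2 / ln 2.
(* As 100 * 1024 = 2 * (100 * 256) * 2, this [delta] is what ensures 2N <= n. *)
exists (ln 2 / 1024), c; split; first by rewrite divr_gt0.
split; first by rewrite divr_gt0 // !mulr_gt0.
exists 2%N => n n2 n_even b b0 b_le.
have n2R : (2 : R) <= n%:R by rewrite ler_nat.
have n0R : 0 < n%:R :> R by apply: lt_le_trans n2R.
have b0R : 0 < b%:R :> R by rewrite ltr0n.
have lnn : ln 2 <= ln n%:R :> R by rewrite ler_ln ?posrE.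
have lnn0 : 0 < ln n%:R :> R by exact: lt_le_trans lnn.
have {}b_le : 100 * 1024 * (b%:R * ln n%:R) <= ln 2 * n%:R :> R.
  move: b_le; rewrite ler_pdivlMr ?mulr_gt0 //.
  rewrite [leRHS]mulrAC ler_pdivlMr // => h; apply: le_trans _ h; rewrite le_eqVlt.
  by apply/orP; left; apply/eqP; ring.
have bn : (b <= n)%N.
  rewrite -(ler_nat R) -(ler_pM2l ln2); apply: le_trans b_le.
  rewrite mulrC; apply: le_trans (ler_wpM2l (ltW b0R) lnn) _.
  by rewrite ler_peMl ?mulr_ge0 ?ltW //; lra.
have lnm : ln (maxn b 2)%:R <= ln n%:R :> R.
  by rewrite ler_ln ?posrE // ?ltr0n ?ler_nat ?geq_max ?bn ?n2 // leq_max orbT.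
pose L := (trunc_log 2 b).+1; pose N := (100 * 256 * b * L)%N.
have bL : (b < 2 ^ L)%N by exact: trunc_log_ltn.
have Lln : L%:R * ln 2 <= 2 * ln (maxn b 2)%:R :> R by exact: log_bound.
have NE : N%:R = 100 * 256 * (b%:R * L%:R) :> R by rewrite /N !natrM !mulrA.
have bLln : b%:R * L%:R * ln 2 <= 2 * (b%:R * ln (maxn b 2)%:R) :> R.
  by rewrite -mulrA [leRHS]mulrCA ler_pM2l.
have nN : (2 * N <= n)%N.
  rewrite -(ler_nat R) natrM NE -(ler_pM2l ln2); apply: le_trans b_le.
  have : b%:R * ln (maxn b 2)%:R <= b%:R * ln n%:R :> R by rewrite ler_pM2l.
  move: bLln; move: (b%:R * L%:R) (b%:R * ln _) (b%:R * ln _) => x y z.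
  by move: (ln 2) => t; lra.
exists (n./2 - N + (32 * N).+1)%N; split; last first.
  exact: (@maker_wins_perfect_matching R n b L).
have N0 : (0 < N)%N by rewrite !muln_gt0 b0.
have nE : n%:R / 2 = n./2%:R :> R.
  by rewrite -{1}(odd_double_half n) (negPf n_even) add0n -muln2 natrM mulfK ?pnatr_eq0.
(* The pairing phase stops N moves short of n/2; since N >= 1, this covers the spare move. *)
rewrite nE; apply: le_trans (_ : (n./2 + 32 * N)%:R <= _).
  by rewrite ler_nat; move: N0 nN n_even; move: (N); clear; lia.
rewrite natrD lerD2l natrM NE /c.
have -> : 32 * (100 * 256) * 2 / ln 2 * b%:R * ln (maxn b 2)%:R =
  32 * (100 * 256 * (2 * (b%:R * ln (maxn b 2)%:R) / ln 2)) :> R.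
  by field; rewrite gt_eqF.
apply: ler_wpM2l => //; apply: ler_wpM2l; first by rewrite mulr_ge0.
by rewrite ler_pdivlMr.
Qed.
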